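(* For any integer $n \geq 3$, the number of $(213, 312)$-avoiding flattened partitions satisfies the recurrence relation $|\mathcal{F}(n; 213, 312)| = |\mathcal{F}(n-1; 213, 312)| + 1$, with initial condition $|\mathcal{F}(2; 213, 312)| = 1$.
   Context: For a positive integer $n$, $[n]=\{1,\dots,n\}$, and a permutation $\sigma$ of $[n]$ is written as the word $\sigma(1)\sigma(2)\cdots\sigma(n)$. A run of $\sigma$ is a maximal block of consecutive positions on which $\sigma$ is increasing, so $\sigma$ is uniquely the concatenation of its runs; the starting point of a run is its first entry. A flattened partition over $[n]$ is a permutation of $[n]$ whose runs, read from left to right, have increasing starting points. A permutation contains a pattern $\tau$ if it has a (not necessarily contiguous) subsequence order-isomorphic to $\tau$; otherwise it is $\tau$-avoiding. $\mathcal{F}(n;\tau_1,\tau_2)$ is the set of flattened partitions over $[n]$ avoiding both $\tau_1$ and $\tau_2$ (these are called $(\tau_1,\tau_2)$-avoiding). *)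

(* Defs.v *)
From mathcomp Require Import all_boot all_fingroup.

Set Implicit Arguments.
Unset Strict Implicit.
Unset Printing Implicit Defensive.

(* 'S_n permutes {0, ..., n-1}; the shift by one gives the usual word over
   {1, ..., n}. *)
Definition word (n : nat) (s : 'S_n) : seq nat := [seq (s i).+1 | i <- enum 'I_n].

Fixpoint runs (w : seq nat) : seq (seq nat) :=
  if w is x :: w' then
    if runs w' is (y :: r) :: rs then
      if x < y then (x :: y :: r) :: rs else [:: x] :: (y :: r) :: rs
    else [:: [:: x]]
  else [::].

(* The next four lemmas say that [runs w] is the decomposition of w into its
   maximal increasing blocks: the blocks are nonempty and increasing, w is their
   concatenation, and no block can be extended into the next one. *)
Lemma runs_nonempty (w : seq nat) : all (fun r => r != [::]) (runs w).
Proof.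
elim: w => //= x w; case: (runs w) => [|[|y r] rs] //= IHw.
by case: ifP.
Qed.

Lemma flatten_runs (w : seq nat) : flatten (runs w) = w.
Proof.
elim: w => //= x w; have := runs_nonempty w.
case: (runs w) => [|[|y r] rs] //= _ IHw; first by rewrite -IHw.
by case: ifP => _; rewrite -IHw.
Qed.

Lemma runs_increasing (w : seq nat) : all (sorted ltn) (runs w).
Proof.
elim: w => //= x w; case: (runs w) => [|[|y r] rs] //= IHw.
by case: ifP => /= [->|_].
Qed.

Lemma runs_maximal (w : seq nat) :
  sorted (fun r1 r2 => head 0 r2 <= last 0 r1) (runs w).
Proof.
elim: w => //= x w; case: (runs w) => [|[|y r] rs] //= IHw.
case: ltnP => [_|le_yx] /=; last by rewrite le_yx.
by case: rs IHw => [|r2 rs].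
Qed.

Definition flattened (w : seq nat) : bool :=
  sorted ltn [seq head 0 r | r <- runs w].

Definition order_isomorphic (u v : seq nat) : bool :=
  (size u == size v) &&
  [forall i : 'I_(size u), forall j : 'I_(size u),
     (nth 0 u i < nth 0 u j) == (nth 0 v i < nth 0 v j)].

(* The subsequences of w are the words [mask m w], m a bit vector. *)
Definition contains (w tau : seq nat) : bool :=
  [exists m : (size w).-tuple bool, order_isomorphic (mask m w) tau].

Lemma containsP (w tau : seq nat) :
  reflect (exists2 u, subseq u w & order_isomorphic u tau) (contains w tau).
Proof.
apply: (iffP existsP) => [[m iso_m]|[_ /subseqP[m sz_m ->] iso_m]].
  by exists (mask m w) => //; apply: mask_subseq.
by exists (Tuple (introT eqP sz_m)).
Qed.

Definition avoids (w tau : seq nat) : bool := ~~ contains w tau.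

Definition flattened_avoiding (n : nat) (tau1 tau2 : seq nat) : {set 'S_n} :=
  [set s | [&& flattened (word s), avoids (word s) tau1 & avoids (word s) tau2]].

(* Main.v *)
Require Import Defs.
From mathcomp Require Import all_boot all_fingroup.

(** A word avoids 213 and 312 when no letter lies below both an earlier and a
later letter.  Let such a word be flattened and take three consecutive letters
y z t.  If z < y, then t < z is forced by avoidance, and then z alone is a run,
followed by a run that starts at t < z: the starting points do not increase.
So y < z, and the only possible descent is the one into the last letter
([prefix_increasing]).  Conversely, an increasing word followed by one letter x
avoids both patterns, since each of them starts with a descent that is not its
last step, and it is flattened exactly when its first letter is less than x
([flattened_avoiding_rcons]).

A permutation whose word is increasing up to the last letter is determined by
that last letter ([eq_of_increasing_prefix]), which can be any letter except
the least one ([flattened_avoidingE]).  Hence there are n - 1 such permutations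
for n >= 2 ([card_flattened_avoiding]), and the recurrence follows. *)

Set Implicit Arguments.
Unset Strict Implicit.
Unset Printing Implicit Defensive.

(** * Runs and flattened words *)

Lemma runs_cons (x : nat) (w : seq nat) :
  exists r rs, runs (x :: w) = (x :: r) :: rs.
Proof.
rewrite /=; case: (runs w) => [|[|y r] rs]; [by exists [::], [::]| |].
  by exists [::], [::].
by case: ifP => _; [exists (y :: r), rs | exists [::], ((y :: r) :: rs)].
Qed.

Lemma runs_cons2 (x y : nat) (w : seq nat) :
  runs (x :: y :: w) =
  if x < y then (x :: head [::] (runs (y :: w))) :: behead (runs (y :: w))
  else [:: x] :: runs (y :: w).
Proof.
have [r [rs eq_runs]] := runs_cons y w.
by rewrite [LHS]/= -/(runs (y :: w)) eq_runs.
Qed.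

Lemma runs_cat_descent (p q : seq nat) (y z : nat) :
  z <= y -> runs (rcons p y ++ z :: q) = runs (rcons p y) ++ runs (z :: q).
Proof.
move=> le_zy; elim: p => [|x p IHp].
  by rewrite [rcons _ _ ++ _]/= runs_cons2 ltnNge le_zy.
case: p IHp => [|x' p]; rewrite !rcons_cons !cat_cons !runs_cons2 => ->.
  by case: ifP.
by have [r [rs ->]] := runs_cons x' (rcons p y); case: ifP.
Qed.

Lemma runs_sorted (x : nat) (v : seq nat) :
  path ltn x v -> runs (x :: v) = [:: x :: v].
Proof.
elim: v x => // y v IHv x /= /andP[lt_xy /IHv].
by rewrite /= => ->; rewrite lt_xy.
Qed.

(** Between two descents the middle letter is a run by itself. *)
Lemma flattened_no_double_descent (p q : seq nat) (y z t : nat) :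
  z <= y -> flattened (p ++ [:: y, z, t & q]) -> z < t.
Proof.
move=> le_zy; rewrite -cat_rcons /flattened (runs_cat_descent _ _ le_zy).
have [//|le_tz] := ltnP z t.
rewrite (runs_cat_descent [::] q le_tz) map_cat.
have [r [rs ->]] := runs_cons t q.
by move/cat_sorted2 => [_] /= /andP[lt_zt _]; rewrite ltnNge le_tz in lt_zt.
Qed.

(** There is either one run, or two runs with starting points h and x. *)
Lemma flattened_rcons (h x : nat) (v : seq nat) :
  path ltn h v -> flattened (rcons (h :: v) x) = (h < x).
Proof.
move=> inc_v; have [lt_last|le_last] := ltnP (last h v) x.
  have inc_vx : path ltn h (rcons v x) by rewrite rcons_path inc_v.
  rewrite /flattened rcons_cons runs_sorted //=.
  have /allP/(_ x) := order_path_min ltn_trans inc_vx.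
  by rewrite mem_rcons mem_head => ->.
rewrite /flattened -cats1 lastI runs_cat_descent // -lastI runs_sorted //=.
by rewrite andbT.
Qed.

(** * The patterns 213 and 312 *)

Lemma order_isomorphic3P (u : seq nat) (t0 t1 t2 : nat) :
  reflect (exists a b c, u = [:: a; b; c] /\
            forall i j, i < 3 -> j < 3 ->
              (nth 0 u i < nth 0 u j) =
              (nth 0 [:: t0; t1; t2] i < nth 0 [:: t0; t1; t2] j))
          (order_isomorphic u [:: t0; t1; t2]).
Proof.
apply: (iffP andP) => [[]|[a [b [c [-> iso_u]]]]].
  case: u => [|a [|b [|c [|d u]]]] // _ /forallP iso_u.
  exists a, b, c; split=> // i j lt_i lt_j.
  by have /forallP/(_ (Ordinal lt_j))/eqP := iso_u (Ordinal lt_i).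
split=> //; apply/forallP => i; apply/forallP => j; apply/eqP.
exact: iso_u.
Qed.

(** Two letters above a middle one form 213 or 312, according to their order. *)
Lemma valley_contains (w : seq nat) (a b c : nat) :
  uniq w -> subseq [:: a; b; c] w -> b < a -> b < c ->
  contains w [:: 2; 1; 3] || contains w [:: 3; 1; 2].
Proof.
move=> uniq_w sub_w lt_ba lt_bc.
have neq_ac : a != c.
  by have := subseq_uniq sub_w uniq_w; rewrite /= !inE negb_or => /andP[/andP[]].
have nlt_ab := leq_gtF (ltnW lt_ba).
have nlt_cb := leq_gtF (ltnW lt_bc).
case: (ltngtP a c) neq_ac => // lt_ac _; apply/orP; [left | right];
  apply/containsP; exists [:: a; b; c] => //;
  apply/order_isomorphic3P; exists a, b, c; split=> //;
  have nlt_ca := leq_gtF (ltnW lt_ac);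
  case=> [|[|[|i]]] [|[|[|j]]] //= _ _;
  by rewrite ?ltnn ?lt_ba ?lt_bc ?lt_ac ?nlt_ab ?nlt_cb ?nlt_ca.
Qed.

Lemma subseq_rcons2 (T : eqType) (u v : seq T) (y x : T) :
  subseq (rcons u y) (rcons v x) -> subseq u v.
Proof.
rewrite -subseq_rev !rev_rcons /= -[subseq u v]subseq_rev.
by case: eqP => // _; apply/subseq_trans/subseq_cons.
Qed.

(** The first two letters of an occurrence lie in the increasing part. *)
Lemma avoids_increasing_rcons (v : seq nat) (x t0 t1 t2 : nat) :
  sorted ltn v -> t1 < t0 -> avoids (rcons v x) [:: t0; t1; t2].
Proof.
move=> inc_v lt_t; apply/negP => /containsP[u sub_u /order_isomorphic3P].
move=> [a [b [c [def_u /(_ 1 0 isT isT)]]]].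
rewrite {}def_u /= lt_t in sub_u * => lt_ba.
have := @subseq_rcons2 _ [:: a; b] v c x sub_u.
move/(subseq_sorted ltn_trans)/(_ inc_v) => /= /andP[lt_ab _].
by rewrite ltnNge ltnW in lt_ab.
Qed.

(** * Flattened words that avoid both patterns *)

Lemma prefix_increasing (v : seq nat) (x : nat) :
  uniq (rcons v x) -> flattened (rcons v x) ->
  avoids (rcons v x) [:: 2; 1; 3] -> avoids (rcons v x) [:: 3; 1; 2] ->
  sorted ltn v.
Proof.
move=> uniq_w flat_w av213 av312; apply/(sortedP 0) => i lt_i.
have [//|le_zy] := ltnP (nth 0 v i) (nth 0 v i.+1); exfalso.
(* The prefix v ends at position i.+1 at the earliest, so x guarantees a letter
   t after the descent y z. *)
set w := rcons v x in uniq_w flat_w av213 av312.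
have lt_i2 : i.+2 < size w by rewrite size_rcons.
have def_w : w = take i w ++ [:: nth 0 v i, nth 0 v i.+1, nth 0 w i.+2
                              & drop i.+3 w].
  rewrite -[LHS](cat_take_drop i) (drop_nth 0) 1?(drop_nth 0 (n := i.+1)).
  - by rewrite (drop_nth 0 lt_i2) /w !nth_rcons lt_i (ltnW lt_i).
  - exact: ltnW.
  - exact: ltnW (ltnW lt_i2).
have lt_zt : nth 0 v i.+1 < nth 0 w i.+2.
  by move: flat_w; rewrite {1}def_w; exact: flattened_no_double_descent.
have neq_yz : nth 0 v i.+1 != nth 0 v i.
  have uniq_v : uniq v by move: uniq_w; rewrite rcons_uniq => /andP[].
  by rewrite nth_uniq ?(ltnW lt_i) // gtn_eqF.
have lt_zy : nth 0 v i.+1 < nth 0 v i by rewrite ltn_neqAle neq_yz.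
have sub_w : subseq [:: nth 0 v i; nth 0 v i.+1; nth 0 w i.+2] w.
  rewrite {2}def_w; apply: subseq_trans (suffix_subseq _ _).
  exact: (prefix_subseq [:: _; _; _]).
by case/orP: (valley_contains uniq_w sub_w lt_zy lt_zt); apply/negP.
Qed.

Lemma flattened_avoiding_rcons (h x : nat) (v : seq nat) :
  uniq (rcons (h :: v) x) ->
  [&& flattened (rcons (h :: v) x), avoids (rcons (h :: v) x) [:: 2; 1; 3]
    & avoids (rcons (h :: v) x) [:: 3; 1; 2]] = path ltn h v && (h < x).
Proof.
move=> uniq_w; apply/and3P/andP => [[flat_w av213 av312]|[inc_v lt_hx]].
  have inc_v : path ltn h v := prefix_increasing uniq_w flat_w av213 av312.
  by rewrite -(flattened_rcons x inc_v).
by rewrite flattened_rcons //; split=> //; apply: avoids_increasing_rcons.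
Qed.

(** * Permutations with an increasing word up to the last letter *)

Lemma word_uniq (n : nat) (s : 'S_n) : uniq (word s).
Proof.
rewrite map_inj_uniq ?enum_uniq // => i j [] /val_inj; exact: perm_inj.
Qed.

Lemma word_inj (n : nat) : injective (@word n).
Proof.
move=> s t /eq_in_map eq_st; apply/permP => i.
by have [] := eq_st i (mem_enum _ _) => /val_inj.
Qed.

Lemma perm_word (n : nat) (s t : 'S_n) : perm_eq (word s) (word t).
Proof.
have sub (s' t' : 'S_n) : {subset word s' <= word t'}.
  move=> _ /mapP[i _ ->]; apply/mapP; exists ((t'^-1)%g (s' i)).
    by rewrite mem_enum.
  by rewrite permKV.
by apply: uniq_perm; rewrite ?word_uniq // => x; apply/idP/idP; apply: sub.
Qed.

Definition word_prefix (m : nat) (s : 'S_m.+1) : seq nat :=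
  [seq (s (lift ord_max i)).+1 | i <- enum 'I_m].

Lemma word_rcons (m : nat) (s : 'S_m.+1) :
  word s = rcons (word_prefix s) (s ord_max).+1.
Proof.
rewrite /word enum_ordSr map_rcons -map_comp; congr (rcons _ _).
by apply: eq_map => i /=; congr (s _).+1; apply: ord_inj; rewrite lift_max.
Qed.

Lemma word_prefix_cons (m : nat) (s : 'S_m.+2) :
  exists v, word_prefix s = (s ord0).+1 :: v.
Proof.
rewrite /word_prefix enum_ordSl; eexists; congr ((s _).+1 :: _).
exact: val_inj.
Qed.

(** The prefix is the increasing rearrangement of all the other letters. *)
Lemma eq_of_increasing_prefix (m : nat) (s t : 'S_m.+1) :
  sorted ltn (word_prefix s) -> sorted ltn (word_prefix t) ->
  s ord_max = t ord_max -> s = t.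
Proof.
move=> inc_s inc_t eq_last; apply: word_inj; rewrite !word_rcons eq_last.
congr (rcons _ _); apply: irr_sorted_eq inc_s inc_t _.
- exact: ltn_trans.
- exact: ltnn.
apply: perm_mem; have := perm_word s t.
by rewrite !word_rcons eq_last -!cats1 perm_cat2r.
Qed.

(** [lift_perm ord_max b 1] moves the letter b of the identity to the end. *)
Lemma increasing_prefix_lift_perm (m : nat) (b : 'I_m.+1) :
  sorted ltn (word_prefix (lift_perm ord_max b 1%g)).
Proof.
rewrite /word_prefix (eq_map (g := fun i : 'I_m => (bump b i).+1)); last first.
  by move=> i; rewrite lift_perm_lift perm1.
rewrite (map_comp (fun k => (bump b k).+1) val) val_enum_ord.
apply: homo_sorted (iota_ltn_sorted 0 m) => i j lt_ij.
suff: bump b i < bump b j by [].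
by rewrite ltnNge leq_bump2 -ltnNge.
Qed.

(** * The count *)

Lemma flattened_avoidingE (m : nat) :
  flattened_avoiding m.+2 [:: 2; 1; 3] [:: 3; 1; 2] =
  [set lift_perm ord_max b 1%g | b in [set~ (ord0 : 'I_m.+2)]].
Proof.
have memF (s : 'S_m.+2) :
    (s \in flattened_avoiding m.+2 [:: 2; 1; 3] [:: 3; 1; 2]) =
    sorted ltn (word_prefix s) && (s ord0 < s ord_max).
  have := word_uniq s; rewrite inE word_rcons.
  have [v ->] := word_prefix_cons s; exact: flattened_avoiding_rcons.
apply/setP => s; rewrite memF; apply/andP/imsetP => [[inc_s lt_s]|[b b_n0 ->]].
  exists (s ord_max).
    by rewrite !inE -lt0n; apply: leq_ltn_trans lt_s.
  apply: eq_of_increasing_prefix => //; last by rewrite lift_perm_id.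
  exact: increasing_prefix_lift_perm.
split; first exact: increasing_prefix_lift_perm.
have -> : ord0 = lift ord_max (ord0 : 'I_m.+1) by apply: val_inj.
have {b_n0} b_gt0 : 0 < b by move: b_n0; rewrite !inE -lt0n.
by rewrite lift_perm_lift lift_perm_id perm1 /= /bump [b <= 0]leqNgt b_gt0.
Qed.

Lemma card_flattened_avoiding (m : nat) :
  #|flattened_avoiding m.+2 [:: 2; 1; 3] [:: 3; 1; 2]| = m.+1.
Proof.
rewrite flattened_avoidingE card_imset; first by rewrite cardsC1 card_ord.
by move=> b c /permP/(_ ord_max); rewrite !lift_perm_id.
Qed.

Theorem proposition3p10 :
  #|flattened_avoiding 2 [:: 2; 1; 3] [:: 3; 1; 2]| = 1 /\
  (forall n : nat, 3 <= n ->
     #|flattened_avoiding n [:: 2; 1; 3] [:: 3; 1; 2]| =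
     #|flattened_avoiding (n - 1) [:: 2; 1; 3] [:: 3; 1; 2]| + 1).
Proof.
split; first exact: card_flattened_avoiding.
by case=> [|[|[|n]]] // _; rewrite subn1 !card_flattened_avoiding addn1.
Qed.
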